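(* Let $0<\alpha\le 1$ and let $T:X\to\mathcal{R}_\Omega(Y)$ be a linear random operator. The following statements are equivalent. (i) $T$ is probably Lipschitzian with probability $\ge\alpha$: for every $0<\varepsilon<\alpha$ there is $M_\varepsilon>0$ such that $\mathbb{P}[\|T(x)-T(y)\|\le M_\varepsilon\|x-y\|]>\varepsilon$ for all $x,y\in X$. (ii) $T$ is probably uniformly continuous with probability $\ge\alpha$: for all $\tau>0$ and $0<\varepsilon<\alpha$ there is $\delta>0$ such that $\mathbb{P}[\|T(x)-T(y)\|<\tau]>\varepsilon$ whenever $x,y\in X$ and $\|x-y\|<\delta$. (iii) $T$ is probably continuous with probability $\ge\alpha$: for every $x_0\in X$, $T$ is probably continuous at $x_0$ with probability $\ge\alpha$. (iv) There is some $x_0\in X$ such that $T$ is probably continuous at $x_0$ with probability $\ge\alpha$. (v) For all $\tau>0$ and $0<\varepsilon<\alpha$ there is $\delta>0$ such that $\mathbb{P}[\|T(x)\|<\tau]>\varepsilon$ whenever $x\in X$ and $\|x\|<\delta$. (vi) $T$ is probably bounded with probability $\ge\alpha$: for every $0<\varepsilon<\alpha$ there is $M_\varepsilon>0$ such that $\mathbb{P}[\|T(x)\|\le M_\varepsilon]>\varepsilon$ for all $x\in X$ with $\|x\|\le 1$. (vii) For every $0<\varepsilon<\alpha$ there is a constant $M_\varepsilon\ge 0$ such that $\mathbb{P}[\|T(x)\|\le M_\varepsilon\|x\|]>\varepsilon$ for all $x\in X$.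
   Context: $(\Omega,\mathcal{A},\mathbb{P})$ is a fixed probability space, and $X$ and $Y$ are Banach spaces over the same scalar field ($\mathbb{R}$ or $\mathbb{C}$). A $Y$-valued random variable is a map $y:\Omega\to Y$ such that $y^{-1}(B)\in\mathcal{A}$ for every Borel set $B\subset Y$. $\mathcal{R}_\Omega(Y)$ denotes the linear space (taken as such throughout) of all $Y$-valued random variables on $\Omega$, with almost surely equal random variables identified. For $y\in\mathcal{R}_\Omega(Y)$ and $\tau\in\mathbb{R}$, $[\|y\|<\tau]=\{\omega\in\Omega:\|y(\omega)\|<\tau\}$, and similarly for $\le$, $=$, etc. A linear random operator is a map $T:X\to\mathcal{R}_\Omega(Y)$ such that $\mathbb{P}[T(ax+by)=aT(x)+bT(y)]=1$ for all $x,y\in X$ and all scalars $a,b$. $T$ is probably continuous at $x_0\in X$ with probability $\ge\alpha$ if for all $\tau>0$ and $0<\varepsilon<\alpha$ there is $\delta>0$ such that $\mathbb{P}[\|T(x)-T(x_0)\|<\tau]>\varepsilon$ whenever $x\in X$ and $\|x-x_0\|<\delta$. *)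

(* Defs.v *)
From HB Require Import structures.
From mathcomp Require Import all_boot all_order all_algebra.
From mathcomp Require Import complex.
From mathcomp Require Import all_classical all_reals all_analysis.

Set Implicit Arguments.
Unset Strict Implicit.
Unset Printing Implicit Defensive.

Import Order.TTheory GRing.Theory Num.Theory.
Import numFieldNormedType.Exports.

Local Open Scope classical_set_scope.
Local Open Scope ring_scope.

Variant scalars := RealScalars | ComplexScalars.

(* Norms of [normedModType K] take their values in [K], so the radii and
   constants compared with a norm below range over [K]. When [K] is [R[i]],
   [0 < t] and [0 <= t] hold only for real [t], so these still range over the
   positive (nonnegative) reals. *)
Definition scalar_field (R : realType) (s : scalars) : numFieldType :=
  match s with
  | RealScalars => R
  | ComplexScalars => R[i]
  end.

Section RandomVariables.
Context {d : measure_display} {Omega : measurableType d} {R : realType}.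
Context (P : probability Omega R) {K : numFieldType}.

Definition borel_space (Y : normedModType K) := g_sigma_algebraType (@open Y).

Definition random_variables (Y : normedModType K) : Type :=
  {mfun_ P, Omega >-> borel_space Y}.

(* A representative of the class: it is an actual Borel random variable. *)
Definition rv_fun (Y : normedModType K) (y : random_variables Y) : Omega -> Y :=
  aqEqMfun_to_fun y.

(* For nonseparable [Y] the sum of two Borel random variables need not be
   Borel measurable, so that random variables form a linear space is a genuine
   condition on [Omega] and [Y]. *)
Definition random_variables_linear (Y : normedModType K) : Prop :=
  forall (a b : K) (f g : Omega -> Y),
    measurable_fun setT (f : Omega -> borel_space Y) ->
    measurable_fun setT (g : Omega -> borel_space Y) ->
    measurable_fun setT ((fun w => a *: f w + b *: g w) : Omega -> borel_space Y).

End RandomVariables.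

Coercion rv_fun : random_variables >-> Funclass.

Section RandomOperators.
Context {d : measure_display} {Omega : measurableType d} {R : realType}.
Context {P : probability Omega R} {K : numFieldType}.
Context {X Y : normedModType K}.
Implicit Types (T : X -> random_variables P Y) (alpha : R).

Definition linear_random_operator T : Prop :=
  forall (a b : K) (x y : X),
    P [set w | T (a *: x + b *: y) w = a *: T x w + b *: T y w] = 1%E.

Definition probably_lipschitzian alpha T : Prop :=
  forall e : R, 0 < e < alpha ->
  exists2 M : K, 0 < M &
    forall x y : X, (e%:E < P [set w | (`|T x w - T y w| <= M * `|x - y|)%R])%E.

Definition probably_uniformly_continuous alpha T : Prop :=
  forall (tau : K) (e : R), 0 < tau -> 0 < e < alpha ->
  exists2 delta : K, 0 < delta &
    forall x y : X, `|x - y| < delta ->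
      (e%:E < P [set w | (`|T x w - T y w| < tau)%R])%E.

Definition probably_continuous_at alpha T (x0 : X) : Prop :=
  forall (tau : K) (e : R), 0 < tau -> 0 < e < alpha ->
  exists2 delta : K, 0 < delta &
    forall x : X, `|x - x0| < delta ->
      (e%:E < P [set w | (`|T x w - T x0 w| < tau)%R])%E.

Definition probably_continuous alpha T : Prop :=
  forall x0 : X, probably_continuous_at alpha T x0.

Definition probably_bounded alpha T : Prop :=
  forall e : R, 0 < e < alpha ->
  exists2 M : K, 0 < M &
    forall x : X, `|x| <= 1 -> (e%:E < P [set w | (`|T x w| <= M)%R])%E.

End RandomOperators.

(* Main.v *)
(* Almost sure linearity makes the law of [|T x - T y|] that of [|T (x - y)|]
   and the law of [|T (a x)|] that of [|a| |T x|]. Hence every condition can be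
   moved to the origin and rescaled, as for bounded linear operators.
   Linearity of the space of random variables enters because [P] is meaningful
   only on measurable events: [T x - T y] has to be Borel. *)
Require Import Defs.
From HB Require Import structures.
From mathcomp Require Import all_boot all_order all_algebra.
From mathcomp Require Import complex.
From mathcomp Require Import all_classical all_reals all_analysis.

Set Implicit Arguments.
Unset Strict Implicit.
Unset Printing Implicit Defensive.

Import Order.TTheory GRing.Theory Num.Theory.
Import numFieldNormedType.Exports.

Local Open Scope classical_set_scope.
Local Open Scope ring_scope.

(** * Borel sets and events cut out by the norm *)

Lemma open_norm_lt (K : numFieldType) (Y : normedModType K) (t : K) :
  open [set z : Y | `|z| < t].
Proof.
have -> : [set z : Y | `|z| < t] = ball (0 : Y) t.
  by apply/seteqP; split => z; rewrite -ball_normE /ball_ /= sub0r normrN.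
exact: ball_open.
Qed.

Lemma open_norm_gt (K : numFieldType) (Y : normedModType K) (t : K) :
  open [set z : Y | t < `|z|].
Proof.
(* By the reverse triangle inequality, the ball of radius [|y| - t] about [y] stays in the set. *)
rewrite openE => y /= ty; apply/nbhs_ballP; exists (`|y| - t) => /=.
  by rewrite subr_gt0.
move=> z; rewrite -ball_normE /ball_ /= ltrBrDr -ltrBrDl => /lt_le_trans; apply.
by rewrite lerBlDr -lerBlDl lerB_dist.
Qed.

Section BorelRandomVariables.
Context (d : measure_display) (Omega : measurableType d) (R : realType).
Context (P : probability Omega R) (K : numFieldType) (Y : normedModType K).

Lemma measurable_norm_lt (t : K) :
  measurable ([set z : Y | `|z| < t] : set (borel_space Y)).
Proof. by apply: sub_sigma_algebra; exact: open_norm_lt. Qed.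

(** The order of [K] is only partial, as for [R[i]]. The condition [0 <= t] makes [t] comparable
    with every norm, so that the complement of the closed ball is the open set of larger norms. *)
Lemma measurable_norm_le (t : K) : 0 <= t ->
  measurable ([set z : Y | `|z| <= t] : set (borel_space Y)).
Proof.
move=> t0.
have -> : [set z : Y | `|z| <= t] = ~` [set z : Y | t < `|z|].
  apply/seteqP; split => z /=; rewrite real_leNgt ?ger0_real//; first by move/negP.
  by move=> h; apply/negP.
by apply: measurableC; apply: sub_sigma_algebra; exact: open_norm_gt.
Qed.

(** Applied to a difference, this makes the event that two random variables agree measurable. *)
Lemma measurable_norm_eq0 :
  measurable ([set z : Y | z = 0] : set (borel_space Y)).
Proof.
have -> : [set z : Y | z = 0] = [set z : Y | `|z| <= 0].
  by apply/seteqP; split => z /=; rewrite normr_le0 => /eqP.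
exact: measurable_norm_le.
Qed.

Lemma measurable_rv (y : random_variables P Y) :
  measurable_fun setT (y : Omega -> borel_space Y).
Proof. exact: measurable_funPT. Qed.

Lemma measurable_preimage (f : Omega -> Y) (D : set Y) :
  measurable_fun setT (f : Omega -> borel_space Y) ->
  measurable (D : set (borel_space Y)) -> measurable [set w | D (f w)].
Proof. by move=> mf mD; rewrite -[X in measurable X]setTI; exact: mf. Qed.

End BorelRandomVariables.

Arguments measurable_norm_lt {K} Y t.
Arguments measurable_norm_le {K} Y [t] _.
Arguments measurable_norm_eq0 {K} Y.

(** Adjoining the null set [~] E[changes neither probability, and the union of a set with]~[E]
    depends only on its trace on [E]. *)
Lemma probability_eq_on (d : measure_display) (Omega : measurableType d)
  (R : realType) (P : probability Omega R) (E A B : set Omega) :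
  measurable E -> measurable A -> measurable B -> P E = 1%E ->
  E `&` A = E `&` B -> P A = P B.
Proof.
move=> mE mA mB PE EAB.
have mC : measurable (~` E) by exact: measurableC.
have PC : P (~` E) = 0%E by rewrite probability_setC// PE subee.
rewrite -(measureU0 mA mC PC) -(measureU0 mB mC PC).
have UE D : D `|` ~` E = (E `&` D) `|` ~` E by rewrite setUIl setUv setTI.
by rewrite UE EAB -UE.
Qed.

(** * Laws under almost sure linearity *)

Section LinearRandomOperator.
Context (d : measure_display) (Omega : measurableType d) (R : realType).
Context (P : probability Omega R) (K : numFieldType) (X Y : normedModType K).
Context (hY : random_variables_linear (Omega := Omega) Y).
Context (T : X -> random_variables P Y).
Context (hT : linear_random_operator T).

Lemma measurable_lin (a b : K) (x y : X) :
  measurable_fun setT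
    ((fun w => a *: T x w + b *: T y w) : Omega -> borel_space Y).
Proof. by apply: hY; exact: measurable_rv. Qed.

Lemma probability_lin (a b : K) (x y : X) (D : set Y) :
  measurable (D : set (borel_space Y)) ->
  P [set w | D (T (a *: x + b *: y) w)] = P [set w | D (a *: T x w + b *: T y w)].
Proof.
move=> mD; apply: probability_eq_on (hT a b x y) _.
(* The event where linearity holds is the zero set of this difference, which is Borel by [hY]. *)
- have mB : measurable_fun setT ((fun w => 1 *: T (a *: x + b *: y) w
      + (- 1) *: (a *: T x w + b *: T y w)) : Omega -> borel_space Y).
    by apply: hY; [exact: measurable_rv|exact: measurable_lin].
  have := measurable_preimage mB (measurable_norm_eq0 Y).
  congr (measurable _); apply/seteqP; split=> w /=; rewrite scale1r scaleN1r.
    by move/eqP; rewrite subr_eq0 => /eqP.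
  by move=> ->; rewrite subrr.
- exact: measurable_preimage (measurable_rv _) mD.
- exact: measurable_preimage (measurable_lin _ _ _ _) mD.
- by apply/seteqP; split=> w /= [Ew]; rewrite Ew.
Qed.

Lemma probabilityB (x y : X) (D : set Y) :
  measurable (D : set (borel_space Y)) ->
  P [set w | D (T (x - y) w)] = P [set w | D (T x w - T y w)].
Proof.
move=> mD; have := probability_lin 1 (- 1) x y mD.
rewrite scale1r scaleN1r => ->; congr (P _).
by apply/seteqP; split=> w /=; rewrite scale1r scaleN1r.
Qed.

Lemma probabilityZ (a : K) (x : X) (D : set Y) :
  measurable (D : set (borel_space Y)) ->
  P [set w | D (T (a *: x) w)] = P [set w | D (a *: T x w)].
Proof.
move=> mD; have := probability_lin a 0 x x mD.
rewrite scale0r addr0 => ->; congr (P _).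
by apply/seteqP; split=> w /=; rewrite scale0r addr0.
Qed.

(** [T 0] vanishes only almost surely, so its law is read off from [0 = 0 *: 0] and homogeneity. *)
Lemma probability0 (D : set Y) : measurable (D : set (borel_space Y)) ->
  D 0 -> P [set w | D (T 0 w)] = 1%E.
Proof.
move=> mD D0; rewrite -(scale0r (0 : X)) probabilityZ//.
have -> : [set w | D (0 *: T 0 w)] = setT.
  by apply/seteqP; split=> w //= _; rewrite scale0r.
exact: probability_setT.
Qed.

Lemma probability_norm_ltB (x y : X) (t : K) :
  P [set w | `|T (x - y) w| < t] = P [set w | `|T x w - T y w| < t].
Proof. exact: probabilityB (measurable_norm_lt Y t). Qed.

Lemma probability_norm_leB (x y : X) (t : K) : 0 <= t ->
  P [set w | `|T (x - y) w| <= t] = P [set w | `|T x w - T y w| <= t].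
Proof. by move=> t0; exact: probabilityB (measurable_norm_le Y t0). Qed.

Lemma probability_norm_le0 (t : K) : 0 <= t ->
  P [set w | `|T 0 w| <= t] = 1%E.
Proof.
by move=> t0; apply: (probability0 (measurable_norm_le Y t0)); rewrite /= normr0.
Qed.

Lemma probability_norm_leZ (a : K) (x : X) (t : K) : a != 0 -> 0 <= t ->
  P [set w | `|T (a *: x) w| <= `|a| * t] = P [set w | `|T x w| <= t].
Proof.
move=> a0 t0; have at0 : 0 <= `|a| * t by rewrite mulr_ge0.
rewrite (probabilityZ a x (measurable_norm_le Y at0)).
by congr (P _); apply/seteqP; split=> w /=; rewrite normrZ ler_pM2l ?normr_gt0.
Qed.

Lemma measurable_rv_norm_lt (x : X) (t : K) : measurable [set w | `|T x w| < t].
Proof.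
exact: measurable_preimage (measurable_rv (T x)) (measurable_norm_lt Y t).
Qed.

Lemma measurable_rv_norm_le (x : X) (t : K) : 0 <= t ->
  measurable [set w | `|T x w| <= t].
Proof.
move=> t0.
exact: measurable_preimage (measurable_rv (T x)) (measurable_norm_le Y t0).
Qed.

(** * The implications between the conditions *)

Context (alpha : R).

Lemma probably_lipschitzian_uniformly_continuous :
  probably_lipschitzian alpha T -> probably_uniformly_continuous alpha T.
Proof.
move=> lipT tau e tau0 /lipT[M M0 ltM]; exists (tau / M) => [|x y xy].
  by rewrite divr_gt0.
have Mxy : 0 <= M * `|x - y| by rewrite mulr_ge0// ltW.
(* Both events are expressed through the single random variable [T (x - y)]; they are then
   measurable, and one contains the other because [M * |x - y| < tau]. *)
rewrite -probability_norm_ltB.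
have := ltM x y; rewrite -probability_norm_leB//.
move=> /lt_le_trans; apply; apply: le_measure; rewrite ?inE.
- exact: measurable_rv_norm_le.
- exact: measurable_rv_norm_lt.
- by move=> w /= /le_lt_trans; apply; rewrite mulrC -ltr_pdivlMr.
Qed.

Lemma probably_continuous_at_small (x0 : X) :
  probably_continuous_at alpha T x0 ->
  forall (tau : K) (e : R), 0 < tau -> 0 < e < alpha ->
  exists2 delta : K, 0 < delta &
    forall x : X, `|x| < delta -> (e%:E < P [set w | (`|T x w| < tau)%R])%E.
Proof.
move=> cT tau e tau0 ea; have [delta delta0 ltP] := cT tau e tau0 ea.
(* Writing [x] as [(x + x0) - x0] turns the law of [|T x|] into that of an increment at [x0]. *)
exists delta => // x xd; rewrite -[x](addrK x0).
by rewrite probability_norm_ltB ltP// addrK.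
Qed.

Lemma small_probably_bounded :
  (forall (tau : K) (e : R), 0 < tau -> 0 < e < alpha ->
   exists2 delta : K, 0 < delta &
     forall x : X, `|x| < delta -> (e%:E < P [set w | (`|T x w| < tau)%R])%E) ->
  probably_bounded alpha T.
Proof.
move=> small e /(small 1 e ltr01)[delta delta0 ltP].
have c0 : 0 < delta / 2 by rewrite divr_gt0.
(* Smallness is used with [tau = 1]. The factor [delta / 2] rather than [delta] sends the closed
   unit ball into the open ball of radius [delta], and scaling by it turns the bound
   [(delta / 2)^-1] into 1. *)
exists (delta / 2)^-1 => [|x x1]; first by rewrite invr_gt0.
rewrite -(@probability_norm_leZ (delta / 2)) ?gt_eqF ?invr_ge0 ?ltW//.
rewrite gtr0_norm// divff ?gt_eqF//.
have /lt_le_trans : (e%:E < P [set w | (`|T ((delta / 2) *: x) w| < 1)%R])%E.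
  apply: ltP; rewrite normrZ gtr0_norm// (le_lt_trans (y := delta / 2))//.
    by rewrite ler_piMr// ltW.
  by rewrite ltr_pdivrMr// ltr_pMr// ltr1n.
apply; apply: le_measure; rewrite ?inE.
- exact: measurable_rv_norm_lt.
- exact: measurable_rv_norm_le.
- by move=> w /ltW.
Qed.

Lemma probably_bounded_homogeneous : alpha <= 1 -> probably_bounded alpha T ->
  forall e : R, 0 < e < alpha -> exists2 M : K, 0 <= M &
    forall x : X, (e%:E < P [set w | (`|T x w| <= M * `|x|)%R])%E.
Proof.
move=> alpha1 bT e ea; have [M M0 ltP] := bT e ea.
exists M => [|x]; first exact: ltW.
have [->|x0] := eqVneq x 0.
  (* At the origin the probability is 1, which exceeds [e] because [e < alpha <= 1]. *)
  rewrite normr0 mulr0 probability_norm_le0//.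
  by case/andP: ea => _ /lt_le_trans; rewrite lte_fin; apply.
have nx0 : `|x| != 0 by rewrite normr_eq0.
(* Away from the origin, [x] is [|x|] times a unit vector, to which the bound on the unit ball
   applies. *)
have -> : [set w | `|T x w| <= M * `|x|] =
          [set w | `|T (`|x| *: (`|x|^-1 *: x)) w| <= `| `|x| | * M].
  by rewrite scalerA divff// scale1r normr_id mulrC.
rewrite probability_norm_leZ ?ltW// ltP// normrZ normfV normr_id mulVf//.
Qed.

Lemma homogeneous_probably_lipschitzian :
  (forall e : R, 0 < e < alpha -> exists2 M : K, 0 <= M &
    forall x : X, (e%:E < P [set w | (`|T x w| <= M * `|x|)%R])%E) ->
  probably_lipschitzian alpha T.
Proof.
(* [M] may be 0, while a Lipschitz constant has to be positive; hence [M + 1]. *)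
move=> hom e /hom[M M0 ltP]; exists (M + 1) => [|x y]; first exact: ltr_wpDl.
have M1 : 0 <= (M + 1) * `|x - y| by rewrite mulr_ge0// addr_ge0.
rewrite -probability_norm_leB//.
apply: lt_le_trans (ltP (x - y)) _; apply: le_measure; rewrite ?inE.
- by apply: measurable_rv_norm_le; rewrite mulr_ge0.
- exact: measurable_rv_norm_le.
- by move=> w /= /le_trans; apply; rewrite ler_wpM2r// lerDl.
Qed.

End LinearRandomOperator.

Theorem theorem3p7 (d : measure_display) (Omega : measurableType d)
  (R : realType) (P : probability Omega R) (s : scalars)
  (X Y : completeNormedModType (scalar_field R s))
  (hY : random_variables_linear (Omega := Omega) Y)
  (alpha : R) (halpha : 0 < alpha <= 1)
  (T : X -> random_variables P Y) (hT : linear_random_operator T) :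
  [<-> (* (i) *) probably_lipschitzian alpha T;
       (* (ii) *) probably_uniformly_continuous alpha T;
       (* (iii) *) probably_continuous alpha T;
       (* (iv) *) exists x0 : X, probably_continuous_at alpha T x0;
       (* (v) *) forall (tau : scalar_field R s) (e : R),
         0 < tau -> 0 < e < alpha ->
         exists2 delta : scalar_field R s, 0 < delta &
           forall x : X, `|x| < delta ->
             (e%:E < P [set w | (`|T x w| < tau)%R])%E;
       (* (vi) *) probably_bounded alpha T;
       (* (vii) *) forall e : R, 0 < e < alpha ->
         exists2 M : scalar_field R s, 0 <= M &
           forall x : X, (e%:E < P [set w | (`|T x w| <= M * `|x|)%R])%E ].
Proof.
have [_ alpha1] := andP halpha.
tfae.
- exact: probably_lipschitzian_uniformly_continuous.
- move=> uT x0 tau e tau0 ea; have [delta delta0 ltP] := uT tau e tau0 ea.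
  by exists delta => // x; exact: ltP.
- by move=> cT; exists 0; exact: cT.
- by case=> x0; exact: probably_continuous_at_small.
- exact: small_probably_bounded.
- exact: probably_bounded_homogeneous.
- exact: homogeneous_probably_lipschitzian.
Qed.
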